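(* For any integer $t\geq 3$, we have $$px_3(K_{3,t})=\begin{cases}2 & \text{if } 3\leq t\leq 12;\\ 3 & \text{otherwise.}\end{cases}$$
   Context: All graphs are simple, finite, undirected and connected. $K_{s,t}$ denotes the complete bipartite graph with partite sets of sizes $s$ and $t$. An edge-coloring of a graph $G$ is any map $c:E(G)\to\{1,\dots,m\}$, $m\in\mathbb{N}$ (adjacent edges may receive the same color). A tree $T$ that is a subgraph of an edge-colored graph $G$ is a proper tree if no two adjacent edges of $T$ are assigned the same color. For $S\subseteq V(G)$, an $S$-tree is a tree that is a subgraph of $G$ and contains all vertices of $S$. For a connected graph $G$ of order $n$ and an integer $k$ with $2\le k\le n$, a $k$-proper coloring of $G$ is an edge-coloring such that for every set $S$ of $k$ vertices of $G$ there exists a proper $S$-tree in $G$. The $k$-proper index $px_k(G)$ is the minimum number of colors required in a $k$-proper coloring of $G$. *)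

(* Defs.v *)
(* MathComp world. *)
From mathcomp Require Import all_boot.

Set Implicit Arguments.
Unset Strict Implicit.
Unset Printing Implicit Defensive.

Record sgraph := SGraph {
  svertex :> finType;
  sedge : rel svertex;
  sedge_sym : symmetric sedge;
  sedge_irrefl : irreflexive sedge
}.

(* E(G), an edge being an unordered pair of adjacent vertices. *)
Definition edges (G : sgraph) : {set {set G}} :=
  [set [set p.1; p.2] | p : G * G & sedge p.1 p.2].

Definition Kbip_rel (s t : nat) : rel ('I_s + 'I_t)%type :=
  fun u v => match u, v with
             | inl _, inr _ | inr _, inl _ => true
             | _, _ => false
             end.

Lemma Kbip_sym s t : symmetric (@Kbip_rel s t).
Proof. by move=> [u|u] [v|v]. Qed.

Lemma Kbip_irrefl s t : irreflexive (@Kbip_rel s t).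
Proof. by case. Qed.

Definition Kbip (s t : nat) : sgraph :=
  SGraph (@Kbip_sym s t) (@Kbip_irrefl s t).

(* A subgraph of G is given by its vertex set W and its edge set F. *)
Definition is_subgraph (G : sgraph) (W : {set G}) (F : {set {set G}}) : Prop :=
  F \subset edges G /\ forall A, A \in F -> A \subset W.

Definition adj_in (G : sgraph) (F : {set {set G}}) : rel G :=
  fun x y => [set x; y] \in F.

Definition connected_sub (G : sgraph) (W : {set G}) (F : {set {set G}}) : Prop :=
  W != set0 /\ forall x y, x \in W -> y \in W -> connect (adj_in F) x y.

(* A single edge xy yields the [ucycle] [:: x; y]; hence the bound on the
   length. *)
Definition acyclic_sub (G : sgraph) (F : {set {set G}}) : Prop :=
  forall p : seq G, 2 < size p -> ~ ucycle (adj_in F) p.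

Definition is_tree (G : sgraph) (W : {set G}) (F : {set {set G}}) : Prop :=
  [/\ is_subgraph W F, connected_sub W F & acyclic_sub F].

(* A map E(G) -> {1, ..., m}; the values of c outside E(G) play no role. *)
Definition edge_coloring (G : sgraph) (m : nat) (c : {set G} -> nat) : Prop :=
  forall A, A \in edges G -> 1 <= c A <= m.

Definition proper_on (G : sgraph) (c : {set G} -> nat) (F : {set {set G}}) : Prop :=
  forall A B, A \in F -> B \in F -> A != B -> A :&: B != set0 -> c A <> c B.

Definition proper_S_tree (G : sgraph) (c : {set G} -> nat) (S : {set G})
    (W : {set G}) (F : {set {set G}}) : Prop :=
  [/\ is_tree W F, proper_on c F & S \subset W].

Definition k_proper_coloring (G : sgraph) (k m : nat) (c : {set G} -> nat) : Prop :=
  edge_coloring m c /\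
  forall S : {set G}, #|S| = k -> exists W F, proper_S_tree c S W F.

(* [is_px k G m] is px_k(G) = m: m is the least number of colors of a k-proper
   coloring of G. *)
Definition is_px (k : nat) (G : sgraph) (m : nat) : Prop :=
  (exists c : {set G} -> nat, k_proper_coloring k m c) /\
  forall m', (exists c : {set G} -> nat, k_proper_coloring k m' c) -> m <= m'.

Lemma is_px_unique k G m1 m2 : is_px k G m1 -> is_px k G m2 -> m1 = m2.
Proof.
by move=> [ex1 min1] [ex2 min2]; apply/eqP; rewrite eqn_leq min1 ?min2.
Qed.

(* Main.v *)
(* With two colors a proper tree is an alternating path, so at most one vertex of the larger
   part on it misses a given color b. Fix b and a vertex i of the smaller part, and consider
   the vertices v of the larger part that can have color b only on the edge iv. On a proper
   tree, such a v either misses b or uses iv with color b, and at most one v does each; hence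
   no three of them lie on a proper tree and there are at most two of them. Every v is of this
   kind for one of the 6 pairs (b, i), the minority color among its three edges, so t <= 12.
   For t <= 12 an explicit coloring is checked by listing alternating paths. With three colors,
   one vertex w colored (2, 3, 1) and all others colored (1, 2, 3) suffice: join w to the three
   vertices of the smaller part and hang at most one more leaf from each. *)
Require Import Defs.
From mathcomp Require Import all_boot.

Set Implicit Arguments.
Unset Strict Implicit.
Unset Printing Implicit Defensive.

(** * Growing proper trees by leaves *)

Section ProperTrees.

Variables (G : sgraph) (c : {set G} -> nat).
Implicit Types (W : {set G}) (F : {set {set G}}) (x y : G).

Lemma adj_in_sym F : symmetric (adj_in F).
Proof. by move=> x y; rewrite /adj_in setUC. Qed.

Lemma mem_edges x y : sedge x y -> [set x; y] \in edges G.
Proof. by move=> xy; apply/imsetP; exists (x, y); rewrite ?inE. Qed.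

Lemma set2_injr x y z : [set x; y] = [set x; z] -> y = z.
Proof.
move=> /setP E; move: (E y) (E z); rewrite !inE !eqxx !orbT.
by move=> /esym/orP[/eqP->|/eqP->] // /orP[]/eqP->.
Qed.

Lemma set2_sedge x y : [set x; y] \in edges G -> sedge x y.
Proof.
case/imsetP=> -[a b] /[!inE] /= ab /setP E.
move: (E x) (E y) (E a) (E b); rewrite !inE !eqxx !orbT.
move=> /esym/orP[]/eqP-> /esym/orP[]/eqP-> //.
- by move=> _ /orP[]/eqP e; move: ab; rewrite e.
- by rewrite sedge_sym.
- by move=> /orP[]/eqP e; move: ab; rewrite e.
Qed.

Definition proper_tree W F := is_tree W F /\ proper_on c F.

Lemma proper_tree1 x : proper_tree [set x] set0.
Proof.
split; last by move=> A B; rewrite inE.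
split.
- by split; [exact: sub0set | move=> A; rewrite inE].
- split; first by apply/set0Pn; exists x; rewrite inE.
  by move=> y z /set1P-> /set1P->; exact: connect0.
- by case=> [|y [|z p]] // _ /andP[/= /andP[]]; rewrite /adj_in inE.
Qed.

Lemma is_tree_leaf W F x y :
  is_tree W F -> x \in W -> y \notin W -> sedge x y ->
  is_tree (y |: W) ([set x; y] |: F).
Proof.
move=> [[FE FW] [W0 Wc] Fa] xW yW xy; set F' := _ |: F.
have adjW a b : adj_in F a b -> a \in W /\ b \in W.
  by move=> /FW /subsetP sAW; rewrite !sAW // !inE eqxx ?orbT.
have adjF' a b : a != y -> b != y -> adj_in F' a b -> adj_in F a b.
  move=> /negPf ay /negPf nby; rewrite /adj_in in_setU1 => /orP[/eqP|//].
  by move/setP/(_ y); rewrite !inE eqxx orbT ![y == _]eq_sym ay nby.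
have adjy b : adj_in F' y b -> b = x.
  rewrite /adj_in in_setU1 => /orP[/eqP E|/adjW[]]; last by rewrite (negPf yW).
  by apply: (@set2_injr y); rewrite E setUC.
have cF a b : a \in W -> b \in W -> connect (adj_in F') a b.
  move=> aW bW; apply: connect_sub (Wc _ _ aW bW) => u v uv.
  by apply: connect1; rewrite /adj_in setU1r.
have cy a : a \in W -> connect (adj_in F') a y.
  move=> aW; apply: connect_trans (cF _ _ aW xW) (connect1 _).
  by rewrite /adj_in setU11.
split.
- split; first by rewrite subUset FE andbT sub1set mem_edges.
  move=> A /setU1P[->|/FW AW]; last by apply: subset_trans AW (subsetUr _ _).
  by apply/subsetP=> z /set2P[]->; rewrite !inE ?eqxx // xW orbT.
- split; first by apply/set0Pn; exists y; rewrite setU11.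
  move=> a b /setU1P[->|aW] /setU1P[->|bW] //.
  + by rewrite (sym_connect_sym (adj_in_sym F')) cy.
  + exact: cy.
  + exact: cF.
(* Rotated to start at [y], a cycle through [y] has both its second and its last vertex equal to
   [x], so it is not simple; a cycle avoiding [y] already lies in [F]. *)
- move=> p p2 pF'; have [py|py] := boolP (y \in p).
    case: (rot_to py) => i q Eq; move: p2 pF'.
    rewrite -(rot_ucycle i) -(size_rot i) Eq.
    case: q {Eq} => [|a q] //; case/lastP: q => [|q b] // _ /andP[/=].
    rewrite rcons_path last_rcons => /and3P[/adjy-> _].
    rewrite adj_in_sym => /adjy->.
    by rewrite mem_rcons inE eqxx /= andbF.
  have /andP[pc pu] := pF'; apply: (Fa p p2); rewrite /ucycle pu andbT.
  apply: (@sub_in_cycle _ [pred z | z != y] _ _ _ p _ pc) => [u v|].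
    by rewrite !inE; apply: adjF'.
  by apply/allP=> z zp; apply: contraNneq py => <-.
Qed.

(** No edge of [F] contains [y], so the new edge can clash only at [x]. *)
Lemma proper_tree_leaf W F x y :
  proper_tree W F -> x \in W -> y \notin W -> sedge x y ->
  (forall A, A \in F -> x \in A -> c A <> c [set x; y]) ->
  proper_tree (y |: W) ([set x; y] |: F).
Proof.
move=> [FT Fp] xW yW xy cx; split; first exact: is_tree_leaf.
have [[_ FW] _ _] := FT.
have new A : A \in F -> A :&: [set x; y] != set0 -> c A <> c [set x; y].
  move=> AF /set0Pn[z /setIP[zA /set2P[]zE]]; rewrite {}zE in zA.
    exact: cx.
  by rewrite (subsetP (FW _ AF) _ zA) in yW.
move=> A B /setU1P[->|AF] /setU1P[->|BF].
- by rewrite eqxx.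
- by move=> _; rewrite setIC => /(new _ BF) /nesym.
- by move=> _ /(new _ AF).
- exact: Fp.
Qed.

End ProperTrees.

(** * Properly colored paths as proper trees *)

(** The vertex type is arbitrary and colors take two vertices, so that the predicate can be
    evaluated on natural numbers and then carried over to the graph. *)
Fixpoint proper_path (T : Type) (e : rel T) (c : T -> T -> nat) (p : seq T) :=
  if p is x :: (y :: q) as p' then
    [&& e x y, if q is z :: _ then c x y != c y z else true & proper_path e c p']
  else true.

(** The path is built from its far end, each new first vertex being a leaf. The second conjunct
    serves the induction: the only tree edge at the head is the first edge of the path, hence the
    only one a new edge must differ from. *)
Lemma proper_path_tree (G : sgraph) (c : {set G} -> nat) (x : G) (p : seq G) :
  uniq (x :: p) ->
  proper_path (@sedge G) (fun y z => c [set y; z]) (x :: p) ->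
  exists F, proper_tree c [set y in x :: p] F /\
    (forall A, A \in F -> x \in A -> exists2 q, p = head x p :: q & A = [set x; head x p]).
Proof.
elim: p x => [|y p IH] x.
  move=> _ _; exists set0; split; last by move=> A; rewrite inE.
  suff -> : [set y in [:: x]] = [set x] by apply: proper_tree1.
  by apply/setP=> y; rewrite !inE.
move=> /= /andP[xp yp] /and3P[xy cxy] /(IH _ yp) [F [FT Fy]].
exists ([set y; x] |: F); split; last first.
  move=> A /setU1P[->|AF xA]; first by exists p; rewrite // setUC.
  have [[_ FW] _ _] := FT.1; have := subsetP (FW _ AF) _ xA.
  by rewrite inE (negPf xp).
have -> : [set z in [:: x, y & p]] = x |: [set z in y :: p].
  by apply/setP=> z; rewrite !inE.
apply: proper_tree_leaf => //.
- by rewrite !inE eqxx.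
- by rewrite inE.
- by rewrite sedge_sym.
move=> A AF yA; have [q pE ->] := Fy A AF yA; move: cxy.
by rewrite pE /= [[set y; x]]setUC => /eqP/nesym.
Qed.

Lemma eq_proper_path (T T' : eqType) (e : rel T) (e' : rel T') c c' (h : T -> T')
    (p : seq T) :
  {in p &, forall x y, e x y = e' (h x) (h y)} ->
  {in p &, forall x y, e x y -> c x y = c' (h x) (h y)} ->
  proper_path e c p -> proper_path e' c' (map h p).
Proof.
elim: p => // x [|y p] // IH he hc /and3P[exy cxy pp].
have xp : x \in [:: x, y & p] by rewrite inE eqxx.
have yp : y \in [:: x, y & p] by rewrite !inE eqxx orbT.
have sub z : z \in y :: p -> z \in [:: x, y & p] by rewrite [in X in _ -> X]inE orbC => ->.
apply/and3P; split.
- by rewrite -he.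
- case: p IH he hc pp cxy xp yp sub => //= z p IH he hc /andP[eyz _].
  by move=> cxy xp yp sub; rewrite -!hc // !inE eqxx !orbT.
- by apply: IH pp => u v /sub u' /sub v'; [apply: he | apply: hc].
Qed.

(** * Colorings of complete bipartite graphs given by matrices *)

(** For an edge [A] the maximum ranges over a single pair. *)
Definition edge_color s t (f : 'I_s -> 'I_t -> nat) (A : {set Kbip s t}) : nat :=
  \max_(p : 'I_s * 'I_t | A == [set inl p.1; inr p.2]) f p.1 p.2.

Lemma edge_colorE s t (f : 'I_s -> 'I_t -> nat) i j :
  edge_color f [set inl i; inr j] = f i j.
Proof.
rewrite /edge_color (big_pred1 (i, j)) // => -[i' j'] /=.
apply/eqP/eqP => [/setP E|[-> ->] //].
move: (E (inl i)) (E (inr j)); rewrite !inE !eqxx !orbT /= orbF.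
by move=> /esym/eqP[->] /esym/eqP[->].
Qed.

Lemma Kbip_edgeP s t (A : {set Kbip s t}) :
  reflect (exists i j, A = [set inl i; inr j]) (A \in edges (Kbip s t)).
Proof.
apply: (iffP imsetP) => [[[[i|j] [i'|j']]]|[i [j ->]]]; rewrite ?inE //=.
- by move=> _ ->; exists i, j'.
- by move=> _ ->; exists i', j; rewrite setUC.
- by exists (inl i, inr j); rewrite ?inE.
Qed.

Lemma edge_color_coloring s t m (f : 'I_s -> 'I_t -> nat) :
  (forall i j, 1 <= f i j <= m) -> edge_coloring m (edge_color f).
Proof. by move=> fm A /Kbip_edgeP[i [j ->]]; rewrite edge_colorE. Qed.

(** * Limits of colorings with at most two colors *)

Section TwoColorLowerBound.

Variables (s t : nat) (c : {set Kbip s t} -> nat).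
Hypothesis c12 : forall A, A \in edges (Kbip s t) -> 1 <= c A <= 2.

Definition left_side (x : Kbip s t) : bool := if x is inl _ then true else false.

Definition two (x y : Kbip s t) : bool := c [set x; y] == 2.

(* The edges of an alternating path that leave the larger part all have the same color b, and
   those that enter it have the other one. *)
Lemma alternating_end W F (b : bool) (v : 'I_t) (x y : Kbip s t) p :
  proper_tree c W F -> path (adj_in F) x (y :: p) -> uniq [:: x, y & p] ->
  last y p = inr v -> two x y = b (+) left_side x ->
  exists2 u, [set inl u; inr v] \in F & two (inl u) (inr v) = ~~ b.
Proof.
move=> [[[FE _] _ _] Fp].
have adjE a d : adj_in F a d -> sedge a d by move=> /(subsetP FE)/set2_sedge.
elim: p x y => [|z p IH] x y.
  move=> /= /andP[xy _] _ yv; move: xy; rewrite yv => xv.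
  have := adjE _ _ xv; case: x xv => // u xv _; rewrite addbT => bE.
  by exists u.
move=> /= /and3P[xy yz pp] /andP[xp yp] lv bE.
apply: (IH y z) => //=; first by rewrite yz.
have ncol : c [set x; y] <> c [set y; z].
  apply: Fp xy yz _ _.
    apply/eqP; rewrite setUC => /set2_injr xz.
    by rewrite xz !inE eqxx !orbT in xp.
  by apply/set0Pn; exists y; rewrite !inE eqxx orbT.
have left_sideE : left_side y = ~~ left_side x.
  by have := adjE _ _ xy; case: (x) => ?; case: (y).
rewrite left_sideE; move: bE ncol.
have := c12 (subsetP FE _ xy); have := c12 (subsetP FE _ yz).
rewrite /two; case: (c _) => [|[|[|?]]] //; case: (c _) => [|[|[|?]]] // _ _;
  by case: (b); case: (left_side x).
Qed.

(** Otherwise the tree path from [v] to [v'] leaves the larger part with color [b], so by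
    alternation it enters [v'] with the other color. *)
Lemma monochromatic_unique W F (b : bool) (v v' : 'I_t) :
  proper_tree c W F -> inr v \in W -> inr v' \in W ->
  (forall u, [set inl u; inr v] \in F -> two (inl u) (inr v) = b) ->
  (forall u, [set inl u; inr v'] \in F -> two (inl u) (inr v') = b) -> v = v'.
Proof.
move=> FT vW v'W vb v'b; have [[FE _] [_ Wc] _] := FT.1.
have /connectP[p0 /shortenP[[|y p] pp pu _]] := Wc _ _ vW v'W; first by move=> [].
move=> /esym lp; have /andP[vy _] := pp.
case: y => [u|w] in pp pu lp vy *; last by have /set2_sedge := subsetP FE _ vy.
have [|w /v'b-> /eqP] := alternating_end FT pp pu lp (b := b).
  by rewrite /= addbF -(vb u) /two [[set inl u; _]]setUC.
by case: b {vb v'b}.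
Qed.

Definition minority (b : bool) (i : 'I_s) : {set 'I_t} :=
  [set v | [forall u, (two (inl u) (inr v) == b) ==> (u == i)]].

Lemma card_minority b i :
  (forall S : {set Kbip s t}, #|S| = 3 -> exists W F, proper_S_tree c S W F) ->
  #|minority b i| <= 2.
Proof.
move=> cS; rewrite leqNgt; apply/negP=> /card_gt2P[v1 [v2 [v3 []]]].
move=> [m1 m2 m3] [n12 n23 n31].
have [|W [F [FT Fp /subsetP SW]]] := cS [set inr v1; inr v2; inr v3].
  by rewrite setUC cardsU1 cards2 !inE !(inj_eq (@inr_inj _ _)) negb_or n12 n31 eq_sym n23.
have T : proper_tree c W F by [].
have [[FE _] _ _] := FT.
(* [P v] says that the tree uses the edge from [i] to [v] with color [b]. Two such edges clash at
   [i]; minority vertices without [P] have all their tree edges in the other color. *)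
pose P v := ([set inl i; inr v] \in F) && (two (inl i) (inr v) == b).
have PP v v' : v != v' -> P v -> P v' -> False.
  move=> vv' /andP[vF /eqP vb] /andP[v'F /eqP v'b].
  suff ncol : c [set inl i; inr v] <> c [set inl i; inr v'].
    move: (c12 (subsetP FE _ vF)) (c12 (subsetP FE _ v'F)) vb v'b ncol.
    rewrite /two; case: (c _) => [|[|[|?]]] //; case: (c _) => [|[|[|?]]] //;
      by move=> _ _ <-.
  apply: Fp vF v'F _ _.
    by apply: contra vv' => /eqP/set2_injr[->].
  by apply/set0Pn; exists (inl i); rewrite !inE eqxx.
have nP v : v \in minority b i -> ~~ P v ->
    forall u, [set inl u; inr v] \in F -> two (inl u) (inr v) = ~~ b.
  rewrite inE => /forallP vm Pv u uF.
  have [tb|] := eqVneq (two (inl u) (inr v)) b; last by case: (two _ _); case: (b).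
  have /eqP ui := implyP (vm u) (introT eqP tb).
  by move: uF tb Pv; rewrite ui /P => -> ->; rewrite eqxx.
have NN v v' : v != v' -> v \in minority b i -> v' \in minority b i ->
    inr v \in W -> inr v' \in W -> ~~ P v -> ~~ P v' -> False.
  move=> vv' vm v'm vW v'W vP v'P; apply/(elimN eqP vv').
  exact: (monochromatic_unique T vW v'W (nP _ vm vP) (nP _ v'm v'P)).
have W1 : inr v1 \in W by apply: SW; rewrite !inE eqxx.
have W2 : inr v2 \in W by apply: SW; rewrite !inE eqxx orbT.
have W3 : inr v3 \in W by apply: SW; rewrite !inE eqxx orbT.
(* Two of the three vertices agree on [P], and either way this is impossible. *)
have [] := (PP _ _ n12, PP _ _ n23, PP _ _ n31).
have [] := (NN _ _ n12 m1 m2 W1 W2, NN _ _ n23 m2 m3 W2 W3, NN _ _ n31 m3 m1 W3 W1).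
by case: (P v1); case: (P v2); case: (P v3); intuition.
Qed.

End TwoColorLowerBound.

Lemma card_two_colorable t (c : {set Kbip 3 t} -> nat) :
  k_proper_coloring 3 2 c -> t <= 12.
Proof.
move=> [c12 cS].
have -> : t = #|[set: 'I_t]| by rewrite cardsT card_ord.
have cover : [set: 'I_t] \subset \bigcup_(p : bool * 'I_3) minority c p.1 p.2.
  apply/subsetP=> v _; apply/bigcupP.
  pose f u := two c (inl u) (inr v); pose i0 := @Ordinal 3 0 isT.
  pose i1 := @Ordinal 3 1 isT; pose i2 := @Ordinal 3 2 isT.
  have minP b i : (forall u, u != i -> f u = ~~ b) ->
      exists2 p : bool * 'I_3, true & v \in minority c p.1 p.2.
    move=> fb; exists (b, i) => //; rewrite inE; apply/forallP=> u /=.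
    by apply/implyP; apply: contraLR => /fb; rewrite /f => ->; case: (b).
  have ord3 u : [|| u == i0, u == i1 | u == i2] by case: u => [[|[|[|]]]].
  (* Among three edges two agree; the remaining one gives [i], and the color opposite to the
     agreeing pair gives [b]. *)
  have [f01|f01] := eqVneq (f i0) (f i1).
    by apply: (minP (~~ f i0) i2) => u; case/or3P: (ord3 u) => /eqP->; rewrite ?negbK.
  have [f02|f02] := eqVneq (f i0) (f i2).
    by apply: (minP (~~ f i0) i1) => u; case/or3P: (ord3 u) => /eqP->; rewrite ?negbK.
  apply: (minP (f i0) i0) => u; case/or3P: (ord3 u) => /eqP-> // _.
    by move: f01; case: (f i0); case: (f i1).
  by move: f02; case: (f i0); case: (f i2).
apply: leq_trans (subset_leq_card cover) _.
have /leq_trans : #|\bigcup_(p : bool * 'I_3) minority c p.1 p.2|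
    <= \sum_(p : bool * 'I_3) #|minority c p.1 p.2|.
  elim/big_rec2: _ => [|p n A _ An]; first by rewrite cards0.
  by apply: leq_trans (leq_card_setU _ _).1 _; rewrite leq_add2l.
apply; have -> : 12 = \sum_(p : bool * 'I_3) 2.
  by rewrite sum_nat_const card_prod card_bool card_ord.
by apply: leq_sum => p _; apply: card_minority.
Qed.

(** With a single color, color 2 is absent, so every vertex of the larger part lies in the same
    minority set, which has at most two elements. *)
Lemma two_le_colors t m (c : {set Kbip 3 t} -> nat) :
  2 < t -> k_proper_coloring 3 m c -> 2 <= m.
Proof.
move=> t3 [cm cS]; rewrite leqNgt; apply/negP=> m1.
have c1 A : A \in edges (Kbip 3 t) -> c A = 1.
  move/cm; case: (c A) => [|[|k]] // /andP[_ /leq_ltn_trans/(_ m1)//].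
have c12 A : A \in edges (Kbip 3 t) -> 1 <= c A <= 2 by move/c1->.
have := card_minority c12 true ord0 cS.
suff -> : minority c true ord0 = setT by rewrite cardsT card_ord leqNgt t3.
apply/setP=> v; rewrite !inE; apply/forallP=> u.
by rewrite /two c1 //; apply/Kbip_edgeP; exists u, v.
Qed.

(** * Two-colorings checked by computation *)

(* Found by search: for 3 <= t <= 12 the first t triples, read as the colors at the t
   vertices of the larger part, give a 3-proper 2-coloring. *)
Definition codes : seq (seq nat) :=
  [:: [:: 1; 1; 0]; [:: 1; 1; 0]; [:: 1; 0; 1]; [:: 1; 0; 1]; [:: 0; 1; 1]; [:: 1; 0; 0];
      [:: 1; 0; 0]; [:: 0; 1; 1]; [:: 0; 1; 0]; [:: 0; 1; 0]; [:: 0; 0; 1]; [:: 0; 0; 1]].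

(** Bit 1 stands for color 2 and bit 0 for color 1; out-of-range entries also get color 1, so the
    values are always legal colors. *)
Definition code (i j : nat) : nat := (nth 0 (nth [::] codes j) i == 1).+1.

(* K_(3,t) on the vertices 0, ..., t + 2, where 0, 1, 2 form the smaller part. *)
Definition nat_edge (x y : nat) : bool := (x < 3) (+) (y < 3).

Definition nat_color (x y : nat) : nat :=
  if x < 3 then code x (y - 3) else code y (x - 3).

Definition good (p : seq nat) : bool := uniq p && proper_path nat_edge nat_color p.

(** Paths grow at the front and are filtered after each step, which keeps the enumeration small. *)
Definition extend (t : nat) (ws : seq (seq nat)) : seq (seq nat) :=
  flatten [seq [seq p <- [seq x :: q | x <- iota 0 (3 + t)] | good p] | q <- ws].

(* A longest alternating path has 7 vertices, except that it has 6 if t <= 4. *)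
Definition walks (t : nat) : seq (seq nat) :=
  iter (if t <= 4 then 6 else 7) (extend t) [:: [::]].

(** The paths are narrowed by [x] and then by [y] outside the inner loops, to make the evaluation
    cheap. *)
Definition covered (t : nat) : bool :=
  let I := iota 0 (3 + t) in let through x (ws : seq (seq nat)) := [seq p <- ws | x \in p] in
  let ws := walks t in
  all (fun x => let wx := through x ws in
    all (fun y => let wxy := through y wx in
      all (fun z => has (fun p => z \in p) wxy) I) I) I.

Lemma walksP t p : p \in walks t -> good p && all (fun x => x < 3 + t) p.
Proof.
rewrite /walks; elim: (if _ then _ else _) p => [|n IH] p; first by rewrite inE => /eqP->.
rewrite iterS => /flatten_mapP[q /IH /andP[_ qt]].
by rewrite mem_filter => /andP[-> /mapP[x]]; rewrite mem_iota => /= xt ->; rewrite /= xt.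
Qed.

Lemma covered_3_12 t : 3 <= t <= 12 -> covered t.
Proof.
move=> /andP[t3 t12]; have : t \in iota 3 10 by rewrite mem_iota t3.
by move: t {t3 t12}; apply/allP; vm_compute.
Qed.

Section TwoColoring.

Variable t' : nat.
Let t := t'.+1.

Definition vertex (x : nat) : Kbip 3 t :=
  if x < 3 then inl (inord x) else inr (inord (x - 3)).

Definition index_of (v : Kbip 3 t) : nat :=
  match v with inl i => i | inr j => 3 + j end.

Lemma index_of_lt v : index_of v < 3 + t.
Proof. by case: v => [i|j] /=; rewrite ?ltn_add2l // ltn_addr. Qed.

Lemma index_ofK : cancel index_of vertex.
Proof.
case=> [i|j]; rewrite /vertex /=; first by rewrite ltn_ord inord_val.
by rewrite addKn inord_val.
Qed.

Lemma vertexK x : x < 3 + t -> index_of (vertex x) = x.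
Proof.
rewrite /vertex => xt; case: (ltnP x 3) => x3; rewrite /index_of inordK ?subnKC //.
by rewrite ltn_subLR.
Qed.

Definition two_coloring : {set Kbip 3 t} -> nat :=
  edge_color (fun (i : 'I_3) (j : 'I_t) => code i j).

Lemma sedge_index (u v : Kbip 3 t) : sedge u v = nat_edge (index_of u) (index_of v).
Proof. by case: u => [i|i]; case: v => [j|j]; rewrite /nat_edge /= ?ltn_ord. Qed.

Lemma two_coloring_index (u v : Kbip 3 t) :
  sedge u v -> two_coloring [set u; v] = nat_color (index_of u) (index_of v).
Proof.
case: u => [i|i]; case: v => [j|j] // _; rewrite /nat_color /= ?ltn_ord ?addKn.
  by rewrite /two_coloring edge_colorE.
by rewrite setUC /two_coloring edge_colorE.
Qed.

(** The numeric path through the indices of the three vertices is mapped to an alternating path of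
    the graph, which is a proper tree. *)
Lemma two_coloring_proper : covered t -> k_proper_coloring 3 2 two_coloring.
Proof.
move=> tc; split.
  by apply: edge_color_coloring => i j; rewrite /code; case: (_ == 1).
move=> S S3; have /card_gt2P[x [y [z [[xS yS zS] [xy yz zx]]]]] : 2 < #|S| by rewrite S3.
have SE : S = [set x; y; z].
  apply/esym/eqP; rewrite eqEcard S3; apply/andP; split.
    by apply/subsetP=> v; rewrite !inE => /orP[/orP[]|] /eqP->.
  by rewrite setUC cardsU1 cards2 !inE negb_or zx xy eq_sym yz.
have im v : index_of v \in iota 0 (3 + t) by rewrite mem_iota index_of_lt.
have /hasP[p] := allP (allP (allP tc _ (im x)) _ (im y)) _ (im z).
rewrite !mem_filter => /and3P[yp xp pw] zp.
have /andP[/andP[pu pp] /allP pt] := walksP pw.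
have vK : {in p, cancel vertex index_of} by move=> v /pt /vertexK.
have vp : uniq (map vertex p).
  by rewrite map_inj_in_uniq // => u v up vp /(congr1 index_of); rewrite !vK.
have edgeE : {in p &, forall u v, nat_edge u v = sedge (vertex u) (vertex v)}.
  by move=> u v up vp'; rewrite sedge_index !vK.
have colorE : {in p &, forall u v, nat_edge u v ->
    nat_color u v = two_coloring [set vertex u; vertex v]}.
  by move=> u v up vp' uv; rewrite two_coloring_index ?vK // -edgeE.
have := eq_proper_path (c' := fun u v => two_coloring [set u; v]) edgeE colorE pp.
have memp v : index_of v \in p -> v \in map vertex p.
  by move=> vp'; rewrite -(index_ofK v) map_f.
case: (map vertex p) memp vp => [/(_ _ xp)//|v q memp vq vpp].
have [F [[FT Fp] _]] := proper_path_tree vq vpp.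
exists [set u in v :: q], F; split=> //; rewrite {}SE.
apply/subsetP=> a /setUP[/set2P[]|/set1P] ->; rewrite in_set; exact: memp.
Qed.

End TwoColoring.

(** * Three colors always suffice *)

Section ThreeColoring.

Variables (t : nat) (w : 'I_t).

(* All vertices but [w] receive the same colors (1, 2, 3); at [w] they are (2, 3, 1). *)
Definition three_coloring : {set Kbip 3 t} -> nat :=
  edge_color (fun (i : 'I_3) j => if j == w then (i.+1 %% 3).+1 else i.+1).

(** A spider with center [w]: its neighbors are [r], and [s] lists the leaves hung from them. *)
Definition spider_vertices (r : seq 'I_3) (s : seq 'I_t) : {set Kbip 3 t} :=
  [set x | match x with inl i => i \in r | inr j => j \in w :: s end].

(** The three colors at [w] are pairwise distinct. *)
Lemma star_tree r : uniq r ->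
  exists F, proper_tree three_coloring (spider_vertices r [::]) F /\
    forall A, A \in F -> exists2 i, i \in r & A = [set inr w; inl i].
Proof.
elim: r => [_|i r IH /= /andP[ir /IH [F [FT FA]]]].
  exists set0; split; last by move=> A; rewrite inE.
  suff -> : spider_vertices [::] [::] = [set inr w] by apply: proper_tree1.
  by apply/setP=> -[i|j]; rewrite !inE.
exists ([set inr w; inl i] |: F); split; last first.
  move=> A /setU1P[->|/FA[k kr ->]]; first by exists i; rewrite ?inE ?eqxx.
  by exists k; rewrite ?inE ?kr ?orbT.
have -> : spider_vertices (i :: r) [::] = inl i |: spider_vertices r [::].
  by apply/setP=> -[k|k]; rewrite !inE.
apply: proper_tree_leaf => //; rewrite ?inE ?eqxx //.
move=> A /FA[k kr ->] _; rewrite ![[set inr w; _]]setUC /three_coloring !edge_colorE eqxx.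
have ki : k != i by apply: contraNneq ir => <-.
by case: k i ki {ir kr} => [[|[|[|]]]] // ? [[|[|[|]]]].
Qed.

(** The second conjunct serves the induction: the vertices of the smaller part with index at least
    [size s] are still free, carrying only their edge to [w]. *)
Lemma spider_tree s : uniq (w :: s) -> size s <= 3 ->
  exists F, proper_tree three_coloring (spider_vertices (enum 'I_3) s) F /\
    forall A (i : 'I_3), A \in F -> size s <= i -> inl i \in A -> A = [set inl i; inr w].
Proof.
elim: s => [|j s IH] /=.
  have [F [FT FA]] := star_tree (enum_uniq 'I_3).
  move=> _ _; exists F; split=> // A i /FA[k _ ->] _.
  by rewrite !inE /= => /eqP[->]; rewrite setUC.
rewrite inE negb_or => /and3P[/andP[wj ws] js su] s3.
have [|F [FT FA]] := IH _ (ltnW s3); first by rewrite /= ws.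
(* The first free vertex, of index [size s], receives the new leaf; its color there, [i.+1], differs
   from its color at [w]. *)
pose i := Ordinal s3; exists ([set inl i; inr j] |: F); split; last first.
  move=> A k /setU1P[->|AF sk]; last by apply: FA => //; apply: ltnW.
  by move=> sk; rewrite !inE orbF => /eqP[ki]; rewrite ki ltnn in sk.
have -> : spider_vertices (enum 'I_3) (j :: s) =
    inr j |: spider_vertices (enum 'I_3) s.
  by apply/setP=> -[k|k]; rewrite !inE // orbCA.
apply: proper_tree_leaf => //; rewrite ?inE ?mem_enum //.
  by rewrite negb_or eq_sym wj.
move=> A AF iA; rewrite (FA A i AF) // /three_coloring !edge_colorE eqxx eq_sym (negPf wj).
by case: (i) => [[|[|[|]]]].
Qed.

Lemma three_coloring_proper : k_proper_coloring 3 3 three_coloring.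
Proof.
split.
  by apply: edge_color_coloring => i j; case: eqP => _; rewrite ?ltn_pmod ?ltn_ord.
(* Only the vertices of [S] in the larger part other than [w] need to be hung as leaves. *)
move=> S S3; pose s := [seq j <- enum 'I_t | (j != w) && (inr j \in S)].
have sP j : (j \in s) = (j != w) && (inr j \in S) by rewrite mem_filter mem_enum andbT.
have su : uniq (w :: s) by rewrite /= sP eqxx filter_uniq ?enum_uniq.
have s3 : size s <= 3.
  have /andP[_ {}su] := su; rewrite -S3 cardE.
  rewrite -(size_map (@inr 'I_3 'I_t)); apply: uniq_leq_size.
    by rewrite map_inj_uniq // => ? ? [].
  by move=> x /mapP[j]; rewrite sP mem_enum => /andP[_ jS] ->.
have [F [[FT Fp] _]] := spider_tree su s3.
exists (spider_vertices (enum 'I_3) s), F; split=> //.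
apply/subsetP=> -[i|j] xS; rewrite !inE ?mem_enum // sP xS andbT.
by case: eqP.
Qed.

End ThreeColoring.

Theorem theorem4 (t : nat) (ht : 3 <= t) :
  is_px 3 (Kbip 3 t) (if t <= 12 then 2 else 3).
Proof.
case: ifP => t12.
  split; last by move=> m [c]; apply: two_le_colors.
  have /covered_3_12 : 3 <= t <= 12 by rewrite ht.
  case: t ht {t12} => // t _ tc.
  by exists (@two_coloring t); apply: two_coloring_proper.
split.
  case: t ht {t12} => // t _.
  by exists (three_coloring (@ord0 t)); apply: three_coloring_proper.
move=> m [c cP]; have := two_le_colors ht cP.
rewrite leq_eqVlt => /predU1P[m2|//].
by move: cP; rewrite -m2 => /card_two_colorable; rewrite t12.
Qed.
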